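(* Let $K$ be a model of $\mathrm{VFA}$ and $f\in K[x]_\sigma$ a nonzero difference polynomial. (1) The set $\{v(a-b): a,b\in K,\ a\neq b,\ f(a)=f(b)=0\}$ is finite. (2) If $\mathcal B$ is a nested (linearly ordered by inclusion) family of closed balls in $K$ such that each ball in $\mathcal B$ contains a root of $f$ in $K$, then $\bigcap\mathcal B$ contains a root of $f$ in $K$ (in particular it has a $K$-point).
   Context: A transformal valued field is a valued field $K$ (valuation $v$, valuation ring $\mathcal O$, maximal ideal $\mathcal M$, value group $\Gamma$) with a field endomorphism $\sigma$ with $\sigma^{-1}(\mathcal O)=\mathcal O$, $\sigma^{-1}(\mathcal M)=\mathcal M$. A model of $\mathrm{VFA}$ is such a field of equal characteristic which is perfect, inversive ($x\mapsto x^p$ and $\sigma$ surjective, $p$ the characteristic exponent) and $\omega$-increasing ($n\alpha<\sigma\alpha$ for all $0<\alpha\in\Gamma$, $n\in\mathbf N$). $K[x]_\sigma$ is the ring of difference polynomials, i.e. polynomials over $K$ in $x,x^\sigma,x^{\sigma^2},\dots$, evaluated using $\sigma$. A closed ball is a set $\{x\in K: v(x-c)\ge\gamma\}$ with $c\in K$, $\gamma\in\Gamma$. *)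

(* Defs.v *)
From HB Require Import structures.
From mathcomp Require Import all_boot all_order all_algebra finmap.
From mathcomp Require Import boolp classical_sets functions cardinality.
From mathcomp Require Import monalg.

Set Implicit Arguments.
Unset Strict Implicit.
Unset Printing Implicit Defensive.

Import Order.TTheory GRing.Theory.
Local Open Scope classical_set_scope.
Local Open Scope ring_scope.

Record oagType := OrderedAbelianGroup {
  oag_sort :> porderZmodType;
  oag_le_total : forall x y : oag_sort, (x <= y) || (y <= x);
  oag_leD2l : forall x y z : oag_sort, x <= y -> z + x <= z + y
}.

(* [option G] is the ordered monoid obtained from [G] by adding a top element  *)
(* [None], the value of 0.                                                     *)
Section ValueMonoid.
Variable G : oagType.
Implicit Types a b : option G.

Definition vle a b : bool :=
  match a, b with
  | _, None => true
  | None, Some _ => false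
  | Some x, Some y => x <= y
  end.

Definition vlt a b : bool := ~~ vle b a.

Definition vmin a b : option G := if vle a b then a else b.

Definition vadd a b : option G :=
  match a, b with
  | Some x, Some y => Some (x + y)
  | _, _ => None
  end.

End ValueMonoid.

(* [valuation_surj] says that [G] is the value group of [v]. *)
Record valuation (K : fieldType) (G : oagType) := Valuation {
  valuation_fun :> K -> option G;
  valuation_eq_infty : forall x, valuation_fun x = None <-> x = 0;
  valuationM : forall x y,
    valuation_fun (x * y) = vadd (valuation_fun x) (valuation_fun y);
  valuationD : forall x y,
    vle (vmin (valuation_fun x) (valuation_fun y)) (valuation_fun (x + y));
  valuation_surj : forall g : G, exists x, valuation_fun x == Some g
}.

Section TransformalValuedField.
Variables (K : fieldType) (G : oagType) (v : valuation K G).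
Variable sigma : {rmorphism K -> K}.

Definition valuation_ring : set K := [set x | vle (Some 0) (v x)].

Definition maximal_ideal : set K := [set x | vlt (Some 0) (v x)].

Definition closed_ball (c : K) (g : G) : set K :=
  [set x | vle (Some g) (v (x - c))].

Definition transformal : Prop :=
  sigma @^-1` valuation_ring = valuation_ring /\
  sigma @^-1` maximal_ideal = maximal_ideal.

(* The endomorphism of the value group induced by [sigma], computed on an      *)
(* arbitrary representative; see [value_sigmaE]. The default 0 is never used.  *)
Definition value_sigma (g : G) : G :=
  odflt 0 (v (sigma (xchoose (valuation_surj v g)))).

(* The residue field has characteristic [p] when the image of [p] in it is     *)
(* zero, that is, when [p%:R] lies in the maximal ideal.                       *)
Definition residue_pchar (p : nat) : Prop := prime p /\ maximal_ideal p%:R.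

Definition equal_characteristic : Prop :=
  forall p : nat, p \in [pchar K] <-> residue_pchar p.

Definition characteristic_exponent (p : nat) : Prop :=
  p \in [pchar K] \/ (p = 1%N /\ [pchar K] =i pred0).

Definition perfect : Prop :=
  forall p : nat, characteristic_exponent p ->
  forall y : K, exists x, x ^+ p = y.

Definition inversive : Prop := forall y : K, exists x, sigma x = y.

Definition omega_increasing : Prop :=
  forall (g : G) (n : nat), 0 < g -> g *+ n < value_sigma g.

Record VFA : Prop := {
  VFA_transformal : transformal;
  VFA_equal_characteristic : equal_characteristic;
  VFA_perfect : perfect;
  VFA_inversive : inversive;
  VFA_omega_increasing : omega_increasing
}.

End TransformalValuedField.

(* The variable of index [i] stands for the [i]-th transform of x. *)
Definition dpoly (K : fieldType) := {malg K[{cmonom nat}]}.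

Definition dmonom_eval (K : fieldType) (sigma : K -> K) (a : K)
    (m : {cmonom nat}) : K :=
  \prod_(i <- finsupp m) iter i sigma a ^+ m i.

Definition deval (K : fieldType) (sigma : K -> K) (f : dpoly K) (a : K) : K :=
  mmap idfun (dmonom_eval sigma a) f.

Section ValuationTheory.
Variables (K : fieldType) (G : oagType) (v : valuation K G).

Lemma valuation_neq0 (x : K) : x != 0 -> exists g, v x = Some g.
Proof.
move=> x0; case E: (v x) => [g|]; first by exists g.
by move/valuation_eq_infty: E x0 => ->; rewrite eqxx.
Qed.

Lemma valuation_ring_div (x y : K) : y != 0 ->
  valuation_ring v (x / y) <-> vle (v y) (v x).
Proof.
move=> y0; have [g vy] := valuation_neq0 y0.
have -> : v x = vadd (v (x / y)) (Some g) by rewrite -vy -valuationM divfK.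
rewrite /valuation_ring vy /=.
case: (v (x / y)) => //= h; split => [h0|].
  by rewrite addrC -[X in X <= _]addr0; apply: oag_leD2l.
by move/(@oag_leD2l G _ _ (- g)); rewrite addNr addrC addrK.
Qed.

Lemma value_sigmaE (sigma : {rmorphism K -> K}) (x : K) :
  transformal v sigma -> v (sigma x) = omap (value_sigma v sigma) (v x).
Proof.
move=> [hO _]; have [->|x0] := eqVneq x 0.
  rewrite rmorph0; have /valuation_eq_infty -> // : (0 : K) = 0 by [].
have [g vx] := valuation_neq0 x0; rewrite vx /= /value_sigma.
have := xchooseP (valuation_surj v g); set y := xchoose _ => /eqP vy.
have y0 : y != 0.
  by apply/eqP => /(valuation_eq_infty v); rewrite vy.
have sle z t : t != 0 -> vle (v t) (v z) -> vle (v (sigma t)) (v (sigma z)).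
  move=> t0 /(valuation_ring_div _ t0); rewrite -hO /= fmorph_div.
  by move/valuation_ring_div; apply; rewrite fmorph_eq0.
have := sle x y y0; have := sle y x x0; rewrite vx vy /= lexx.
have [|a ->] := @valuation_neq0 (sigma x); first by rewrite fmorph_eq0.
have [|b ->] := @valuation_neq0 (sigma y); first by rewrite fmorph_eq0.
by move=> /= /(_ isT) ab /(_ isT) ba; congr Some; apply/le_anti/andP.
Qed.

End ValuationTheory.

(* Main.v *)
From HB Require Import structures.
Require Import Defs.
From mathcomp Require Import all_boot all_order all_algebra finmap.
From mathcomp Require Import boolp classical_sets functions cardinality.
From mathcomp Require Import monalg.

(* The difference [c = a - b] of two roots of [f] satisfies a nonzero          *)
(* difference equation that depends only on [f]. Indeed, after splitting the   *)
(* roots according to which iterated leading coefficient of [f] vanishes, some *)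
(* transform of [a] is algebraic over the earlier ones, with a nonvanishing    *)
(* leading coefficient; applying sigma, so are all later transforms. Hence the *)
(* polynomials of degree at most D in the transforms of [a] and [b] span a     *)
(* space of dimension O(D ^ m) with m fixed, whereas the transforms 0, ..., m  *)
(* of [c] have (D + 1) ^ (m + 1) monomials of partial degrees at most D.       *)
(* In such an equation two terms have the same value, and since sigma is       *)
(* omega-increasing, distinct monomials [e] and [e'] determine [v c] from      *)
(* [e (v c) - e' (v c)]; so [v c] takes finitely many values.                  *)
(* If no root lay in a nested intersection of balls, one could keep choosing   *)
(* roots in smaller and smaller balls, with increasing values of differences.  *)

(** The roots of [f] fall into finitely many pieces ([roots_pieces], [deval_pieces]); on each piece
    one transform of the root is algebraic over the earlier ones, with a leading coefficient that
    vanishes nowhere on the piece. To obtain a single equation for all differences between two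
    pieces, rather than one for each pair of roots, the dimension count is made in the ring of all
    functions on the set of pairs: there the two coordinates are single elements and the leading
    coefficients are units ([pieces_dependent]).

    In such a ring [growth] stands in for transcendence degree. Adjoining an element raises the
    exponent by one ([growth_adjoin]), adjoining one that is algebraic with unit leading coefficient
    leaves it unchanged ([growth_algebraic]), and exponent [m] makes [m + 1] elements of degree at
    most 1 dependent ([growth_dependent]). Then [dependent_values_finite] turns the equation into
    finiteness of the values, and [nested_balls_root] deduces the second assertion from the
    first. *)

Set Implicit Arguments.
Unset Strict Implicit.
Unset Printing Implicit Defensive.

Import Order.TTheory GRing.Theory.
Local Open Scope classical_set_scope.
Local Open Scope ring_scope.

(** * Growth of polynomials in a commutative algebra *)

Section PolynomialGrowth.
Variables (K : fieldType) (R : comPzRingType) (iota : {rmorphism K -> R}).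
Implicit Types (A B : set R) (z q w : R).

(** The degree filtration on the subalgebra generated by [A]. The inductive form avoids naming
    monomials in a possibly infinite family, and the inequalities in the constructors make it
    monotone in [D]. *)
Inductive pol A : nat -> R -> Prop :=
| polC D k : pol A D (iota k)
| polX D u : A u -> (0 < D)%N -> pol A D u
| polD D w1 w2 : pol A D w1 -> pol A D w2 -> pol A D (w1 + w2)
| polM D1 D2 D w1 w2 : pol A D1 w1 -> pol A D2 w2 -> (D1 + D2 <= D)%N ->
    pol A D (w1 * w2).

Lemma pol_le A D D' w : (D <= D')%N -> pol A D w -> pol A D' w.
Proof.
move=> + H; elim: H D' => {D w}.
- by move=> D k D' _; apply: polC.
- by move=> D u Au D0 D' DD'; apply: polX => //; apply: leq_trans DD'.
- by move=> D w1 w2 _ IH1 _ IH2 D' DD'; apply: polD; [apply: IH1|apply: IH2].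
- move=> D1 D2 D w1 w2 H1 _ H2 _ DD D' DD'; apply: (polM H1 H2).
  exact: leq_trans DD'.
Qed.

Lemma pol_sub A B D w : A `<=` B -> pol A D w -> pol B D w.
Proof.
move=> AB; elim=> {D w}; try by constructor.
- by move=> D u /AB Bu D0; apply: polX.
- by move=> D1 D2 D w1 w2 _ H1 _ H2 DD; apply: (polM H1 H2).
Qed.

Lemma pol0 A D : pol A D 0.
Proof. by rewrite -(rmorph0 iota); apply: polC. Qed.

Lemma pol1 A D : pol A D 1.
Proof. by rewrite -(rmorph1 iota); apply: polC. Qed.

Lemma polN A D w : pol A D w -> pol A D (- w).
Proof.
move=> H; rewrite -mulN1r -(rmorphN1 iota).
by apply: (polM (polC A 0 _) H).
Qed.

Lemma pol_sum A D (I : eqType) (r : seq I) (F : I -> R) :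
  (forall i, i \in r -> pol A D (F i)) -> pol A D (\sum_(i <- r) F i).
Proof.
move=> H; rewrite big_seq; elim/big_ind: _ => //; first exact: pol0.
by move=> *; apply: polD.
Qed.

Lemma polXn A D w n : pol A D w -> pol A (n * D) (w ^+ n).
Proof.
move=> H; elim: n => [|n IH]; first by rewrite expr0; apply: pol1.
by rewrite exprS; apply: (polM H IH); rewrite mulSn.
Qed.

Lemma pol_prod A n (D : 'I_n -> nat) (F : 'I_n -> R) :
  (forall i, pol A (D i) (F i)) -> pol A (\sum_i D i)%N (\prod_i F i).
Proof.
move=> H; elim/big_ind2: _ => //; first exact: pol1.
by move=> D1 w1 D2 w2 H1 H2; apply: (polM H1 H2).
Qed.

(** The degree [D] bounds the coefficients only; powers of [z] are counted separately by [n]. *)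
Definition polz A z n D w := exists2 p : nat -> R,
  (forall j, pol A D (p j)) & w = \sum_(j < n) p j * z ^+ j.

Lemma polzD A z n D w1 w2 :
  polz A z n D w1 -> polz A z n D w2 -> polz A z n D (w1 + w2).
Proof.
move=> [p1 H1 ->] [p2 H2 ->]; exists (fun j => p1 j + p2 j).
  by move=> j; apply: polD.
by rewrite -big_split; apply: eq_bigr => j _; rewrite mulrDl.
Qed.

Lemma polz_sum A z n D m (F : 'I_m -> R) :
  (forall i, polz A z n D (F i)) -> polz A z n D (\sum_i F i).
Proof.
move=> H; elim/big_ind: _ => //; last by move=> *; apply: polzD.
exists (fun=> 0); first by move=> j; apply: pol0.
by rewrite big1 // => j _; rewrite mul0r.
Qed.

Lemma polz_term A z n D p i : (i < n)%N -> pol A D p ->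
  polz A z n D (p * z ^+ i).
Proof.
move=> ilt Hp; exists (fun j => if j == i then p else 0).
  by move=> j; case: eqP => // _; apply: pol0.
rewrite (bigD1 (Ordinal ilt)) //= eqxx big1 ?addr0 // => j.
by rewrite -val_eqE /= => /negPf ->; rewrite mul0r.
Qed.

Lemma polzM A z n D E D' q w : pol A E q -> polz A z n D w ->
  (E + D <= D')%N -> polz A z n D' (q * w).
Proof.
move=> Hq [p Hp ->] le; exists (fun j => q * p j).
  by move=> j; apply: (polM Hq (Hp j)).
by rewrite mulr_sumr; apply: eq_bigr => j _; rewrite mulrA.
Qed.

Lemma pol_adjoin A z D w : pol (z |` A) D w -> polz A z D.+1 D w.
Proof.
elim=> {D w}.
- move=> D k; rewrite -[iota k]mulr1 -(expr0 z).
  by apply: polz_term => //; apply: polC.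
- move=> D u [->|Au] D0.
    have /(_ D.+1 1%N D0) := polz_term z _ (pol1 A D); rewrite mul1r expr1; exact.
  by rewrite -[u]mulr1 -(expr0 z); apply: polz_term => //; apply: polX.
- by move=> D w1 w2 _ H1 _ H2; apply: polzD.
- move=> D1 D2 D w1 w2 _ [p1 H1 ->] _ [p2 H2 ->] le.
  rewrite mulr_suml; apply: polz_sum => i.
  rewrite mulr_sumr; apply: polz_sum => j.
  rewrite mulrACA -exprD; apply: polz_term; last exact: (polM (H1 i) (H2 j)).
  rewrite ltnS; apply: leq_trans le; apply: leq_add; rewrite -ltnS;
  exact: ltn_ord.
Qed.

(** By induction on [j]: multiplying by [q * z] raises each power of [z] by one, and only the top
    one must be rewritten by the equation, so each step costs [E] in the degree. *)
Lemma polz_algebraic A z d E q q' j : q * q' = 1 -> pol A E q ->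
  polz A z d E (q * z ^+ d) -> polz A z d (j * E) (q ^+ j * z ^+ j).
Proof.
move=> qq' Hq Hz; case: d Hz => [|d] Hz.
  (* For [d = 0] the equation reads [q = 0]; as [q] is a unit, the ring is trivial. *)
  have R0 (w : R) : w = 0.
    case: Hz => p _; rewrite big_ord0 expr0 mulr1 => q0.
    by rewrite -[w]mul1r -qq' q0 !mul0r.
  rewrite [X in polz _ _ _ _ X]R0; exists (fun=> 0) => [*|]; first exact: pol0.
  by rewrite big_ord0.
elim: j => [|j [r Hr Er]].
  by rewrite [q ^+ 0]expr0; apply: polz_term => //; apply: pol1.
rewrite !exprSr mulrACA {}Er mulr_suml big_ord_recr /=; apply: polzD.
  apply: polz_sum => i; rewrite mulrACA -exprSr (mulrC _ q).
  apply: polz_term; first by rewrite ltnS.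
  by apply: (polM Hq (Hr i)); rewrite mulSn.
rewrite -mulrA (mulrCA _ q) -exprSr.
by apply: (polzM (Hr d) Hz); rewrite mulSn addnC.
Qed.

(** Of the factor [q ^+ D], the part [q ^+ j] is spent on reducing [z ^+ j], and [q ^+ (D - j)] goes
    into the coefficient; the degrees add up to [D + D * E] for every [j]. *)
Lemma pol_algebraic A z d E q q' D w : q * q' = 1 -> pol A E q ->
  polz A z d E (q * z ^+ d) -> pol (z |` A) D w ->
  polz A z d (D + D * E) (q ^+ D * w).
Proof.
move=> qq' Hq Hz /pol_adjoin[p Hp ->]; rewrite mulr_sumr; apply: polz_sum => j.
have jD : (j <= D)%N by rewrite -ltnS.
rewrite -[in q ^+ D](subnK jD) exprD -mulrA (mulrCA (q ^+ j)).
rewrite (mulrA (q ^+ (D - j))).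
have H1 := polM (polXn (D - j) Hq) (Hp j) (leqnn _).
apply: (polzM H1 (polz_algebraic j qq' Hq Hz)).
by rewrite addnAC -mulnDl subnK // addnC.
Qed.

(** A dimension bound; the spanning elements need not lie in [W]. *)
Definition spanned (W : set R) (r : nat) := exists (I : finType) (l : I -> R),
  (#|I| <= r)%N /\
  forall w, W w -> exists k : I -> K, w = \sum_i iota (k i) * l i.

Lemma spanned_polz A z n D r :
  spanned (pol A D) r -> spanned (polz A z n D) (r * n).
Proof.
move=> [I [l [lr Hl]]].
exists (I * 'I_n)%type, (fun ij : I * 'I_n => l ij.1 * z ^+ ij.2).
split; first by rewrite card_prod card_ord leq_mul2r lr orbT.
move=> w [p Hp ->].
have [k kP] := choice (fun j => Hl _ (Hp j)).
exists (fun ij : I * 'I_n => k ij.2 ij.1).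
rewrite -(pair_bigA _ (fun i (j : 'I_n) => iota (k j i) * (l i * z ^+ j))).
rewrite exchange_big.
apply: eq_bigr => j _; rewrite {1}kP mulr_suml; apply: eq_bigr => i _.
by rewrite mulrA.
Qed.

(** Allows division by powers of a leading coefficient, whose inverse has no bounded degree. *)
Lemma spanned_scale (W W' : set R) q q' r : q * q' = 1 ->
  (forall w, W' w -> W (q * w)) -> spanned W r -> spanned W' r.
Proof.
move=> qq' WW' [I [l [lr Hl]]]; exists I, (fun i => q' * l i); split=> // w.
move=> /WW'/Hl[k E]; exists k.
rewrite -[LHS]mul1r -qq' mulrAC E mulr_suml; apply: eq_bigr => i _.
by rewrite -mulrA [l i * _]mulrC.
Qed.

(** A polynomial bound on the Hilbert function: Gelfand-Kirillov dimension at most [m]. *)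
Definition growth A m := exists C, forall D, spanned (pol A D) (C * D.+1 ^ m).

Lemma growth0 : growth set0 0.
Proof.
exists 1%N => D; exists unit, (fun=> 1); split; first by rewrite card_unit.
suff H w : pol set0 D w -> exists k, w = iota k.
  move=> w /H[k ->]; exists (fun=> k).
  by rewrite (bigD1 tt) //= big1 ?addr0 ?mulr1 // => -[].
elim=> {w} {}D //.
- by move=> k; exists k.
- by move=> w1 w2 _ [k1 ->] _ [k2 ->]; exists (k1 + k2); rewrite rmorphD.
- by move=> ? ? w1 w2 _ [k1 ->] _ [k2 ->] _; exists (k1 * k2); rewrite rmorphM.
Qed.

Lemma growth_sub A B m : A `<=` B -> growth B m -> growth A m.
Proof.
move=> AB [C HC]; exists C => D; have [I [l [lr Hl]]] := HC D.
by exists I, l; split=> // w /(pol_sub AB)/Hl.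
Qed.

Lemma growth_adjoin A z m : growth A m -> growth (z |` A) m.+1.
Proof.
move=> [C HC]; exists C => D; rewrite expnSr mulnA.
apply: (@spanned_scale (polz A z D.+1 D) _ 1 1); first by rewrite mulr1.
  by move=> w; rewrite mul1r => /pol_adjoin.
exact: spanned_polz.
Qed.

(** Up to the unit [q ^+ D], only [d] powers of [z] remain, with coefficients of degree
    [D + D * E < (D + 1) * (E + 1)]. So only the constant grows, not the exponent. *)
Lemma growth_algebraic A z d E q q' m : q * q' = 1 -> pol A E q ->
  polz A z d E (q * z ^+ d) -> growth A m -> growth (z |` A) m.
Proof.
move=> qq' Hq Hz [C HC]; exists (C * E.+1 ^ m * d)%N => D.
have qq'D : q ^+ D * q' ^+ D = 1 by rewrite -exprMn qq' expr1n.
have := HC (D + D * E)%N => /(spanned_polz z d).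
move=> /(spanned_scale qq'D
  (fun w => @pol_algebraic A z d E q q' D w qq' Hq Hz)).
move=> [I [l [lr Hl]]]; exists I, l; split=> //; apply: leq_trans lr _.
rewrite [X in (_ <= X)%N]mulnAC leq_mul2r -[X in (_ <= X)%N]mulnA -expnMn.
apply/orP; right.
rewrite leq_mul2l; apply/orP; right.
have [->|m0] := posnP m; first by rewrite !expn0.
by rewrite leq_exp2r // -mulnS mulnC [X in (_ <= X)%N]mulnS addSn ltnS leq_addl.
Qed.

Lemma spanned_dependent (W : set R) r (J : finType) (w : J -> R) :
  spanned W r -> (forall j, W (w j)) -> (r < #|J|)%N ->
  exists2 k : J -> K, (exists j, k j != 0) & \sum_j iota (k j) * w j = 0.
Proof.
move=> [I [l [lr Hl]]] Ww rJ.
have [k kP] := choice (fun j => Hl _ (Ww j)).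
(* Each row holds the coordinates of one [w j]; with more rows than columns, the left kernel is
   nonzero. *)
pose M := \matrix_(a < #|J|, b < #|I|) k (enum_val a) (enum_val b).
have : ~~ row_free M.
  rewrite /row_free neq_ltn; apply/orP; left.
  exact: leq_ltn_trans (rank_leq_col M) (leq_ltn_trans lr rJ).
rewrite -kermx_eq0 => /rowV0Pn[u /sub_kermxP uM u0].
exists (fun j => u 0 (enum_rank j)).
  have /rV0Pn[b ub] := u0.
  by exists (enum_val b); rewrite enum_valK.
under eq_bigr => j _ do rewrite kP mulr_sumr.
rewrite exchange_big big1 // => i _.
have /rowP/(_ (enum_rank i)) := uM; rewrite !mxE => uMi.
under eq_bigr => j _ do rewrite mulrA -rmorphM.
rewrite -mulr_suml -rmorph_sum (reindex (@enum_val J J)) /=; last first.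
  by apply: onW_bij; apply: enum_val_bij.
under eq_bigr => a _ do rewrite enum_valK.
have -> : \sum_a u 0 a * k (enum_val a) i = 0.
  by rewrite -[RHS]uMi; apply: eq_bigr => a _; rewrite mxE enum_rankK.
by rewrite rmorph0 mul0r.
Qed.

Lemma growth_dependent A m (c : 'I_m.+1 -> R) :
  growth A m -> (forall i, pol A 1 (c i)) ->
  exists D (k : {ffun 'I_m.+1 -> 'I_D.+1} -> K), (exists e, k e != 0) /\
    \sum_e iota (k e) * \prod_i c i ^+ e i = 0.
Proof.
(* The monomials have total degree at most [(m + 1) * D], hence lie in a span of size at most
   [C * (m + 1) ^ m * (D + 1) ^ m]. This choice of [D] makes it [D * (D + 1) ^ m], less than the
   number [(D + 1) ^ (m + 1)] of monomials. *)
move=> [C HC] Hc; pose D := (C * m.+1 ^ m)%N; exists D.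
have H (e : {ffun 'I_m.+1 -> 'I_D.+1}) :
    pol A (m.+1 * D)%N (\prod_i c i ^+ e i).
  apply: (@pol_le _ (\sum_(i < m.+1) e i * 1)%N).
    rewrite -[X in (_ <= X * _)%N](card_ord m.+1) -sum_nat_const.
    by apply: leq_sum => i _; rewrite muln1 -ltnS.
  by apply: pol_prod => i; apply/polXn/Hc.
have [|k k0 kE] := spanned_dependent (HC (m.+1 * D)%N) H; last by exists k.
rewrite card_ffun !card_ord expnS mulSn.
apply: (@leq_ltn_trans (D * D.+1 ^ m)%N); last first.
  by rewrite -[X in (X < _)%N]add0n ltn_add2r expn_gt0.
have -> : (D * D.+1 ^ m = C * m.+1 ^ m * D.+1 ^ m)%N by [].
rewrite -mulnA leq_mul2l -expnMn.
apply/orP; right; have [->|m0] := posnP m; first by rewrite !expn0.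
by rewrite leq_exp2r // [X in (_ <= X)%N]mulnS addSn ltnS leq_addl.
Qed.

End PolynomialGrowth.

(** * Difference algebras *)

Section DifferenceAlgebra.
Variables (K : fieldType) (R : comPzRingType) (iota : {rmorphism K -> R}).
Variables (sigma : K -> K) (s : {rmorphism R -> R}).
Hypothesis s_iota : forall k, s (iota k) = iota (sigma k).
Implicit Types (A : set R) (x y z q w : R) (M : seq {cmonom nat}).

Lemma pol_endo A D w : pol iota A D w -> pol iota (s @` A) D (s w).
Proof.
elim=> {D w}.
- by move=> D k; rewrite s_iota; apply: polC.
- by move=> D u Au D0; apply: polX => //; exists u.
- by move=> D w1 w2 _ H1 _ H2; rewrite rmorphD; apply: polD.
- by move=> D1 D2 D w1 w2 _ H1 _ H2 le; rewrite rmorphM; apply: (polM H1 H2).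
Qed.

Lemma polz_endo A z n D w :
  polz iota A z n D w -> polz iota (s @` A) (s z) n D (s w).
Proof.
move=> [p Hp ->]; exists (s \o p); first by move=> j; apply: pol_endo.
by rewrite rmorph_sum; apply: eq_bigr => j _; rewrite rmorphM rmorphXn.
Qed.

Definition transforms x n : set R := [set iter i s x | i in `I_n].

Lemma transformsS x n : transforms x n.+1 = iter n s x |` transforms x n.
Proof.
apply/seteqP; split=> [_ [i /= + <-]|w].
  by rewrite ltnS leq_eqVlt => /orP[/eqP->|lt]; [left|right; exists i].
case=> [->|[i /= lt <-]]; first by exists n => /=.
by exists i => //=; apply: ltnW.
Qed.

(** As [R] is not a field, the leading coefficient [q] is required to be a unit of [R]. *)
Definition transform_algebraic x n := exists d E q q',
  [/\ q * q' = 1, pol iota (transforms x n) E q &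
      polz iota (transforms x n) (iter n s x) d E (q * iter n s x ^+ d)].

Lemma transform_algebraicS x n :
  transform_algebraic x n -> transform_algebraic x n.+1.
Proof.
have sub : s @` transforms x n `<=` transforms x n.+1.
  by move=> _ [_ [i /= lt <-] <-]; exists i.+1.
move=> [d [E [q [q' [qq' Hq Hz]]]]]; exists d, E, (s q), (s q'); split.
- by rewrite -rmorphM qq' rmorph1.
- exact/(pol_sub sub)/pol_endo.
- have [p Hp Ep] := polz_endo Hz; exists p.
    by move=> j; apply: (pol_sub sub).
  by rewrite iterS -rmorphXn -rmorphM.
Qed.

(** Applying [s] to the equation gives one for every later transform, so all of these are adjoined
    without raising the exponent. *)
Lemma growth_transforms A x n N m : transform_algebraic x n -> (n <= N)%N ->
  growth iota (transforms x n `|` A) m -> growth iota (transforms x N `|` A) m.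
Proof.
move=> xn nN Hm; have {xn nN} : transform_algebraic x N /\
  growth iota (transforms x N `|` A) m; last by case.
elim: N nN => [|N IH]; first by rewrite leqn0 => /eqP E; rewrite E in xn Hm.
rewrite leq_eqVlt => /orP[/eqP <- //|]; rewrite ltnS => /IH[xN HN].
split; first exact: transform_algebraicS.
have [d [E [q [q' [qq' Hq [p Hp Hz]]]]]] := xN.
have sub : transforms x N `<=` transforms x N `|` A by apply: subsetUl.
rewrite transformsS -setUA; apply: (growth_algebraic qq' (pol_sub sub Hq) _ HN).
by exists p => [j|]; [apply: (pol_sub sub)|exact: Hz].
Qed.

Lemma growth_adjoin_transforms A x n m : growth iota A m ->
  growth iota (transforms x n `|` A) (n + m).
Proof.
move=> Hm; elim: n => [|n IH].
  by apply: growth_sub Hm => w [[i /=]|//]; rewrite ltn0.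
by rewrite transformsS -setUA addSn; apply: growth_adjoin.
Qed.

(** Only [n] transforms of [x] and [n'] of [y] contribute to the exponent, however many are
    adjoined; hence [n + n' + 1] transforms of the difference are dependent. *)
Lemma sub_transforms_dependent x y n n' :
  transform_algebraic x n -> transform_algebraic y n' ->
  exists N D (k : {ffun 'I_N -> 'I_D} -> K), (exists e, k e != 0) /\
    \sum_e iota (k e) * \prod_(i < N) (iter i s x - iter i s y) ^+ e i = 0.
Proof.
move=> xn yn; pose m := (n + n')%N; pose N := m.+1.
have nN : (n <= N)%N by rewrite /N /m leqW ?leq_addr.
have nN' : (n' <= N)%N by rewrite /N /m leqW ?leq_addl.
have H0 := growth_adjoin_transforms x n
  (growth_adjoin_transforms y n' (growth0 iota)).
have H1 := growth_transforms xn nN H0.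
have : growth iota (transforms y N `|` (transforms x N `|` set0)) m.
  apply: (growth_transforms yn nN').
  by rewrite addn0 in H1; apply: growth_sub H1 => w; rewrite setUCA.
move=> HN; exists N; have [|D [k Hk]] :=
    growth_dependent (c := fun i : 'I_N => iter i s x - iter i s y) HN.
  move=> i; apply: polD; last apply: polN; apply: polX => //.
    by right; left; exists i => //=.
  by left; exists i => //=.
by exists D.+1, k.
Qed.

Section TruncatedEvaluation.
Variable lam : {cmonom nat} -> K.

(** Exponents of index [n] and above are ignored. Thus a [slice] stands for the coefficient of a
    power of the last variable, with monomials and [lam] left as they are. *)
Definition teval n M x : R :=
  \sum_(m <- M) iota (lam m) * \prod_(i < n) iter i s x ^+ m i.

Definition slice n d M := [seq m <- M | (m : {cmonom nat}) n == d].

Lemma teval_split n d M x : {in M, forall m : {cmonom nat}, (m n <= d)%N} ->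
  teval n.+1 M x = \sum_(j < d.+1) teval n (slice n j M) x * iter n s x ^+ j.
Proof.
move=> Hd; rewrite /teval.
under [RHS]eq_bigr => j _ do rewrite /slice big_filter big_mkcond mulr_suml.
rewrite exchange_big /= big_seq [RHS]big_seq; apply: eq_bigr => m mM.
have lt : (m n < d.+1)%N by rewrite ltnS Hd.
rewrite (bigD1 (Ordinal lt)) //= eqxx [X in _ = _ + X]big1 ?addr0.
  by rewrite big_ord_recr /= mulrA.
by move=> j; rewrite -val_eqE /= eq_sym => /negPf ->; rewrite mul0r.
Qed.

Lemma pol_teval n M M' x : {subset M' <= M} ->
  pol iota (transforms x n) (\max_(m <- M) \sum_(i < n) m i)%N (teval n M' x).
Proof.
move=> sub; apply: pol_sum => m mM'.
apply: (@pol_le _ _ _ _ (\sum_(i < n) m i)%N).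
  apply: (leq_bigmax_seq (F := fun m : {cmonom nat} =>
    \sum_(i < n) m i)%N) => //; exact: sub.
apply: (polM (polC _ _ 0 _) _ (leqnn _)).
rewrite (eq_bigr (fun i : 'I_n => m i * 1)%N); last by move=> i _; rewrite muln1.
apply: pol_prod => i; apply: polXn; apply: polX => //.
by exists i => //=.
Qed.

Lemma teval_algebraic n d M x q' :
  {in M, forall m : {cmonom nat}, (m n <= d)%N} ->
  teval n.+1 M x = 0 -> teval n (slice n d M) x * q' = 1 ->
  transform_algebraic x n.
Proof.
move=> Hd; rewrite (teval_split _ Hd) big_ord_recr /= => E0 qq'.
have sub j : {subset slice n j M <= M}.
  by move=> m; rewrite mem_filter => /andP[].
exists d, (\max_(m <- M) \sum_(i < n) m i)%N, (teval n (slice n d M) x), q'.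
split=> //; first exact: pol_teval.
exists (fun j => - teval n (slice n j M) x).
  by move=> j; apply/polN/pol_teval.
under eq_bigr => j _ do rewrite mulNr.
by rewrite sumrN; apply/eqP; rewrite -addr_eq0 addrC E0.
Qed.

End TruncatedEvaluation.

End DifferenceAlgebra.

(** * Splitting the roots by iterated leading coefficients *)

Lemma bigmax_attained (I : eqType) (r : seq I) (F : I -> nat) : r != [::] ->
  exists2 i, i \in r & F i = (\max_(j <- r) F j)%N.
Proof.
elim: r => // i [|j r] IH _; first by exists i; rewrite ?mem_head ?big_seq1.
have [//|k kr Fk] := IH; rewrite big_cons -Fk.
case: (leqP (F i) (F k)) => [le|lt]; last by exists i; rewrite ?mem_head.
by exists k => //; rewrite inE kr orbT.
Qed.

Section Pieces.
Variables (K : fieldType) (sigma : {rmorphism K -> K}).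
Variable lam : {cmonom nat} -> K.
Implicit Types (M : seq {cmonom nat}) (Z : set K).

Local Notation evalK := (teval idfun sigma lam).

Definition algebraic_piece n Z := exists M d,
  {in M, forall m : {cmonom nat}, (m n <= d)%N} /\
  forall a, Z a -> evalK n.+1 M a = 0 /\ evalK n (slice n d M) a != 0.

(** View the polynomial as one in its last variable. Where the leading coefficient does not vanish,
    the roots form a piece; where it does, recurse on this coefficient. Its monomials share their
    last exponent, so the earlier exponents still tell them apart. *)
Lemma roots_pieces n M : M != [::] -> uniq M -> {in M, forall m, lam m != 0} ->
  {in M &, forall m m' : {cmonom nat},
     (forall i, (i < n)%N -> m i = m' i) -> m = m'} ->
  exists Z : nat -> set K, (forall i, (i < n)%N -> algebraic_piece i (Z i)) /\
    forall a, evalK n M a = 0 -> exists2 i, (i < n)%N & Z i a.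
Proof.
elim: n M => [|n IH] M M0 uM lamM injM.
  exists (fun=> set0); split=> // a; rewrite /teval.
  (* With no variable left, [M] is one monomial and the value is its nonzero coefficient: there is
     no root. *)
  case: M M0 uM lamM injM => // m [|m' M] _ /=.
    move=> _ lamM _; rewrite big_seq1 big_ord0 mulr1 => /eqP.
    by rewrite (negPf (lamM m _)) ?mem_head.
  move=> /andP[mM _] _ injM; case/negP: mM.
  by rewrite (injM m m') ?mem_head // inE mem_head orbT.
pose d := (\max_(m <- M) m n)%N.
have Hd : {in M, forall m : {cmonom nat}, (m n <= d)%N}.
  by move=> m mM; apply: (leq_bigmax_seq (F := fun m : {cmonom nat} => m n)).
pose M' := slice n d M.
have M'P m : m \in M' -> m \in M /\ m n = d.
  by rewrite mem_filter => /andP[/eqP].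
have [||||Z [HZ rootZ]] := IH M'.
- have [m mM mE] := bigmax_attained (fun m : {cmonom nat} => m n) M0.
  have : m \in M' by rewrite mem_filter mM mE eqxx.
  by case: (M').
- exact: filter_uniq.
- by move=> m /M'P[/lamM].
- move=> m m' /M'P[mM mE] /M'P[mM' mE'] E; apply: injM => // i.
  by rewrite ltnS leq_eqVlt => /orP[/eqP ->|/E//]; rewrite mE mE'.
exists (fun i => if i == n
                 then [set a | evalK n.+1 M a = 0 /\ evalK n M' a != 0]
                 else Z i); split.
  move=> i; rewrite ltnS leq_eqVlt; case: eqP => [-> _|_ /= /HZ //].
  by exists M, d.
move=> a Ea; have [/rootZ[i lt Zi]|E'] := eqVneq (evalK n M' a) 0.
  by exists i; [exact: ltnW|rewrite (ltn_eqF lt)].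
by exists n => //; rewrite eqxx.
Qed.

End Pieces.

(** * Relations between two roots *)

Section FunctionRing.
Variables (T : Type) (K : fieldType) (sigma : {rmorphism K -> K}).

Definition const_fun (k : K) : T -> K := fun=> k.

Lemma const_fun_is_zmod_morphism : zmod_morphism const_fun.
Proof. by []. Qed.

Lemma const_fun_is_monoid_morphism : monoid_morphism const_fun.
Proof. by []. Qed.

HB.instance Definition _ :=
  GRing.isZmodMorphism.Build K (T -> K) const_fun const_fun_is_zmod_morphism.
HB.instance Definition _ := GRing.isMonoidMorphism.Build K (T -> K) const_fun
  const_fun_is_monoid_morphism.

Definition post_comp (w : T -> K) : T -> K := sigma \o w.

Lemma post_comp_is_zmod_morphism : zmod_morphism post_comp.
Proof. by move=> w1 w2; apply/funext => t; apply: rmorphB. Qed.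

Lemma post_comp_is_monoid_morphism : monoid_morphism post_comp.
Proof.
by split=> [|w1 w2]; apply/funext => t; [apply: rmorph1|apply: rmorphM].
Qed.

HB.instance Definition _ := GRing.isZmodMorphism.Build (T -> K) (T -> K)
  post_comp post_comp_is_zmod_morphism.
HB.instance Definition _ := GRing.isMonoidMorphism.Build (T -> K) (T -> K)
  post_comp post_comp_is_monoid_morphism.

Lemma iter_post_comp i (w : T -> K) t :
  iter i post_comp w t = iter i sigma (w t).
Proof. by elim: i => //= i; rewrite /post_comp /= => ->. Qed.

Lemma teval_fun lam n M (w : T -> K) t :
  teval const_fun post_comp lam n M w t = teval idfun sigma lam n M (w t).
Proof.
rewrite /teval fct_sumE; apply: eq_bigr => m _.
rewrite mulrfctE fct_prodE; congr (_ * _); apply: eq_bigr => i _.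
by rewrite exprfctE iter_post_comp.
Qed.

(** A leading coefficient that vanishes nowhere on [Z] has its pointwise inverse as inverse in the
    function ring. *)
Lemma algebraic_piece_fun lam n Z (w : T -> K) :
  algebraic_piece sigma lam n Z -> (forall t, Z (w t)) ->
  transform_algebraic const_fun post_comp w n.
Proof.
move=> [M [d [Hd HZ]]] Zw.
apply: (@teval_algebraic _ _ const_fun post_comp lam n d M w
  (fun t => (teval idfun sigma lam n (slice n d M) (w t))^-1)) => //.
  by apply/funext => t; rewrite teval_fun; case: (HZ _ (Zw t)).
apply/funext => t; rewrite mulrfctE teval_fun mulfV //.
by case: (HZ _ (Zw t)).
Qed.

End FunctionRing.

Lemma iter_rmorphB (R : pzRingType) (s : {rmorphism R -> R}) i :
  {morph iter i s : x y / x - y}.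
Proof. by move=> x y; elim: i => //= i ->; rewrite rmorphB. Qed.

(** A relation between functions on the set [T] of pairs has constants as coefficients, hence the
    same [k] at every pair. If [T] is empty the function ring is trivial, which the ring structure
    used above permits. *)
Lemma pieces_dependent (K : fieldType) (sigma : {rmorphism K -> K})
    lam n n' (Z Z' : set K) :
  algebraic_piece sigma lam n Z -> algebraic_piece sigma lam n' Z' ->
  exists N D (k : {ffun 'I_N -> 'I_D} -> K), (exists e, k e != 0) /\
    forall a b, Z a -> Z' b ->
      \sum_e k e * \prod_(i < N) iter i sigma (a - b) ^+ e i = 0.
Proof.
move=> ZP ZP'; pose T := {p : K * K | Z p.1 /\ Z' p.2}.
have xn : transform_algebraic (@const_fun T K) (post_comp sigma)
    (fun t : T => (sval t).1) n.
  by apply: (algebraic_piece_fun ZP) => -[? []].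
have yn : transform_algebraic (@const_fun T K) (post_comp sigma)
    (fun t : T => (sval t).2) n'.
  by apply: (algebraic_piece_fun ZP') => -[? []].
have [//|N [D [k [k0 E]]]] := sub_transforms_dependent (sigma := sigma) _ xn yn.
exists N, D, k; split=> // a b Za Zb.
have := congr1 (fun w => w (exist _ (a, b) (conj Za Zb) : T)) E.
rewrite fct_sumE => E0; rewrite -[RHS]E0; apply: eq_bigr => e _.
rewrite mulrfctE fct_prodE; congr (_ * _); apply: eq_bigr => i _.
by rewrite exprfctE iter_rmorphB addrfctE opprfctE !iter_post_comp.
Qed.

Lemma deval_pieces (K : fieldType) (sigma : {rmorphism K -> K}) (f : dpoly K) :
  f != 0 -> exists n (Z : nat -> set K),
    (forall i, (i < n)%N -> algebraic_piece sigma (fun m => f@_m) i (Z i)) /\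
    forall a, deval sigma f a = 0 -> exists2 i, (i < n)%N & Z i a.
Proof.
move=> f0.
(* A strict bound on the indices of the variables that occur in [f]. *)
pose n := (\max_(m <- msupp f) \max_(i <- finsupp m) i.+1)%N.
have nP m i : m \in msupp f -> (n <= i)%N -> m i = 0%N.
  move=> mf; apply: contraTeq => mi; rewrite -ltnNge.
  apply: leq_trans (leq_bigmax_seq (F := fun m : {cmonom nat} =>
    \max_(i <- finsupp m) i.+1)%N _ mf isT).
  by apply: (leq_bigmax_seq (F := succn)) => //; rewrite mem_finsupp.
have [||||Z [ZP rootZ]] :=
    @roots_pieces K sigma (fun m => f@_m) n (msupp f : seq _).
- apply: contra f0 => /eqP f0; apply/eqP/malgP => m.
  by rewrite mcoeff0 mcoeff_outdom // -[_ \in _]/(m \in enum_fset _) f0.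
- exact: fset_uniq.
- by move=> m; rewrite mcoeff_neq0.
- move=> m m' mf mf' E; apply/eqP/cmP => i.
  have [/E//|le] := ltnP i n; rewrite !nP //.
exists n, Z; split=> // a fa; apply: rootZ.
rewrite -[RHS]fa /deval mmapE /teval; apply: eq_big_seq => m mf.
congr (_ * _); rewrite /dmonom_eval.
rewrite -(big_mkord xpredT (fun i => iter i sigma a ^+ m i)).
have -> : \prod_(i <- finsupp m) iter i sigma a ^+ m i =
    \prod_(i <- [seq i <- index_iota 0 n | i \in finsupp m])
      iter i sigma a ^+ m i.
  apply/perm_big/uniq_perm; rewrite ?fset_uniq ?filter_uniq ?iota_uniq // => i.
  rewrite mem_filter mem_index_iota /= andb_idr // mem_finsupp ltnNge.
  by apply: contra_neqN => /(nP _ _ mf).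
rewrite big_filter [RHS]big_mkcond; apply: eq_bigr => i _.
by rewrite mem_finsupp; case: eqP => //= ->.
Qed.

(** * Ordered groups and valuations *)

Section OrderedAbelianGroup.
Variable G : oagType.
Implicit Types x y z g h : G.

Lemma oag_leP x y : x <= y \/ y < x.
Proof.
have [->|xy] := eqVneq x y; first by left.
have /orP[] := oag_le_total x y; first by left.
by move=> yx; right; rewrite lt_neqAle eq_sym xy.
Qed.

Lemma oag_leD x y x' y' : x <= y -> x' <= y' -> x + x' <= y + y'.
Proof.
move=> xy xy'; apply: (@le_trans _ _ (x + y')); first exact: oag_leD2l.
by rewrite ![_ + y']addrC; apply: oag_leD2l.
Qed.

Lemma oag_ltD2r z x y : x < y -> x + z < y + z.
Proof.
rewrite !lt_neqAle => /andP[xy le]; apply/andP; split.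
  by apply: contra xy => /eqP/addIr ->.
exact: oag_leD.
Qed.

Lemma oag_ltD x y x' y' : x < y -> x' <= y' -> x + x' < y + y'.
Proof. by move=> xy le; apply: lt_le_trans (oag_ltD2r x' xy) (oag_leD _ le). Qed.

Lemma oag_subr_gt0 x y : x < y -> 0 < y - x.
Proof. by move/(oag_ltD2r (- x)); rewrite subrr. Qed.

Lemma oag_mulrn_ge0 x n : 0 <= x -> 0 <= x *+ n.
Proof.
move=> x0; elim: n => [|n IH]; first by rewrite mulr0n.
by rewrite mulrS -[0]addr0; apply: oag_leD.
Qed.

Lemma oag_double_eq0 x : x + x = 0 -> x = 0.
Proof.
move=> xx; case: (oag_leP x 0) => [le|lt].
  apply/le_anti/andP; split=> //.
  by rewrite -{}[X in X <= _]xx -[X in _ <= X]addr0; apply: oag_leD.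
by have := oag_ltD lt (ltW lt); rewrite addr0 xx ltxx.
Qed.

Lemma oag_seq_max (r : seq G) : r != [::] ->
  exists2 g, g \in r & forall h, h \in r -> h <= g.
Proof.
elim: r => // x [|y r] IH _.
  by exists x; rewrite ?mem_head // => h; rewrite inE => /eqP ->.
have [//|g gr gP] := IH; case: (oag_leP x g) => [xg|gx].
  exists g; first by rewrite inE gr orbT.
  by move=> h; rewrite inE => /predU1P[->|/gP].
exists x; first exact: mem_head.
by move=> h; rewrite inE => /predU1P[->//|/gP hg]; apply: le_trans hg (ltW gx).
Qed.

Section OmegaIncreasing.
Variable phi : G -> G.
Hypothesis phiD : {morph phi : g h / g + h}.
Hypothesis phi_lt : forall g n, 0 < g -> g *+ n < phi g.

(** The value of the difference monomial with exponents [e] at an element of value [g]; see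
    [val_dmonom]. *)
Definition wsum N (e : 'I_N -> nat) g := \sum_(i < N) iter i phi g *+ e i.

Lemma iter_phiB i : {morph iter i phi : g h / g - h}.
Proof.
have phiB g h : phi (g - h) = phi g - phi h.
  by apply/eqP; rewrite -subr_eq opprK -phiD subrK.
by move=> g h; elim: i => //= i ->.
Qed.

Lemma wsumB N (e : 'I_N -> nat) g h : wsum e (g - h) = wsum e g - wsum e h.
Proof. by rewrite -sumrB; apply: eq_bigr => i _; rewrite iter_phiB mulrnBl. Qed.

Lemma iter_phi_gt0 i g : 0 < g -> 0 < iter i phi g.
Proof. by move=> g0; elim: i => //= i /(phi_lt 0); rewrite mulr0n. Qed.

Lemma wsum_lt N (e : 'I_N -> nat) g : 0 < g -> wsum e g < iter N phi g.
Proof.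
move=> g0; elim: N e => [|N IH] e; first by rewrite /wsum big_ord0.
rewrite /wsum big_ord_recr /=; have gN := iter_phi_gt0 N g0.
apply: lt_trans (phi_lt (e ord_max).+1 gN).
by rewrite mulrS; apply: oag_ltD2r; apply: IH.
Qed.

(* The values [e i] are the digits of [wsum e g] in an infinite base. *)
Lemma wsum_inj N (e e' : 'I_N -> nat) g : 0 < g ->
  wsum e g = wsum e' g -> e =1 e'.
Proof.
move=> g0; elim: N e e' => [|N IH] e e'; first by move=> _ [].
rewrite /wsum !big_ord_recr /= => E.
have top (d d' : 'I_N.+1 -> nat) : (d ord_max < d' ord_max)%N ->
    \sum_(i < N) iter i phi g *+ d (widen_ord (leqnSn N) i) +
      iter N phi g *+ d ord_max <
    \sum_(i < N) iter i phi g *+ d' (widen_ord (leqnSn N) i) +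
      iter N phi g *+ d' ord_max.
  move=> lt; have gN := iter_phi_gt0 N g0.
  apply: (@lt_le_trans _ _ (iter N phi g *+ (d ord_max).+1)).
    by rewrite mulrS; apply: oag_ltD2r; apply: wsum_lt.
  rewrite -(subnKC lt) mulrnDr -[X in X <= _]add0r.
  apply: oag_leD; last by rewrite -[X in X <= _]addr0; apply: oag_leD2l;
    apply: oag_mulrn_ge0; apply: ltW.
  elim/big_ind: _ => // [x y x0 y0|i _].
    by rewrite -[0]addr0; apply: oag_leD.
  by apply/oag_mulrn_ge0/ltW/iter_phi_gt0.
have Emax : e ord_max = e' ord_max.
  case: (ltngtP (e ord_max) (e' ord_max)) => // /top; by rewrite E ltxx.
move: E; rewrite Emax => /addIr /(IH _ _) Elow i.
case: (unliftP ord_max i) => [j ->|-> //].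
have -> : lift ord_max j = widen_ord (leqnSn N) j.
  by apply/val_inj; rewrite /= /bump leqNgt ltn_ord.
exact: Elow.
Qed.

(** Subtracting the two equations gives [wsum e (h - g) = wsum e' (h - g)]; if [g < h], [wsum_inj]
    forces the exponents to agree. *)
Lemma wsum_eq_unique N (e e' : 'I_N -> nat) x y g h : ~ e =1 e' ->
  x + wsum e g = y + wsum e' g -> x + wsum e h = y + wsum e' h -> g = h.
Proof.
wlog gh : g h / g < h => [H ee' Eg Eh|ee' Eg Eh].
  case: (oag_leP g h) => [|hg]; last by apply/esym/H.
  by rewrite le_eqVlt => /predU1P[//|gh]; apply: H.
case: ee'; apply: (wsum_inj (oag_subr_gt0 gh)).
have H d z : wsum d (h - g) = (z + wsum d h) - (z + wsum d g).
  by rewrite wsumB opprD addrACA subrr add0r.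
by rewrite (H _ e x) (H _ e' y) Eg Eh.
Qed.

End OmegaIncreasing.
End OrderedAbelianGroup.

Section ValuationLemmas.
Variables (K : fieldType) (G : oagType) (v : valuation K G).
Implicit Types x y : K.

Lemma val0 : v 0 = None.
Proof. exact/valuation_eq_infty. Qed.

Lemma val1 : v 1 = Some 0.
Proof.
have [g E] := valuation_neq0 v (oner_neq0 K).
have := valuationM v 1 1; rewrite mulr1 E /= => -[/eqP].
by rewrite -[X in X == _]addr0 => /eqP/addrI <-.
Qed.

Lemma valN x : v (- x) = v x.
Proof.
have N10 : (-1 : K) != 0 by rewrite oppr_eq0 oner_neq0.
have [g E] := valuation_neq0 v N10.
have := valuationM v (-1) (-1); rewrite mulrNN mulr1 val1 E /= => -[/esym g0].
rewrite -mulN1r valuationM E (oag_double_eq0 g0).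
by case: (v x) => //= h; rewrite add0r.
Qed.

Lemma valX x g n : v x = Some g -> v (x ^+ n) = Some (g *+ n).
Proof.
move=> vx; elim: n => [|n IH]; first by rewrite expr0 val1.
by rewrite exprS valuationM vx IH mulrS.
Qed.

Lemma val_prod n (F : 'I_n -> K) (g : 'I_n -> G) :
  (forall i, v (F i) = Some (g i)) -> v (\prod_i F i) = Some (\sum_i g i).
Proof.
move=> H; elim/big_ind2: _ => //; first exact: val1.
by move=> x g1 y g2 Ex Ey; rewrite valuationM Ex Ey.
Qed.

Lemma val_geD g x y :
  vle (Some g) (v x) -> vle (Some g) (v y) -> vle (Some g) (v (x + y)).
Proof.
have := valuationD v x y; rewrite /vmin.
case: (v (x + y)) => //= k; case: (v x) (v y) => [a|] [b|] //=.
- by case: ifP => _ H ga gb; [exact: le_trans H|exact: le_trans H].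
- by move=> H ga _; exact: le_trans H.
- by move=> H _ gb; exact: le_trans H.
Qed.

Lemma val_ltD x y g h : v x = Some g -> v y = Some h -> g < h ->
  v (x + y) = Some g.
Proof.
move=> vx vy gh; have := @val_geD g x y; rewrite vx vy /= lexx.
move=> /(_ isT (ltW gh)).
have H k : g < k -> ~ vle (Some k) (v (x + y)).
  move=> gk Hk.
  (* If [x + y] had value at least [k > g], then [x = (x + y) - y] would have value at least the
     minimum [l] of [k] and [h], which exceeds [g]. *)
  have [l [gl lk lh]] : exists l, [/\ g < l, l <= k & l <= h].
    by case: (oag_leP k h) => [|/ltW]; [exists k|exists h].
  have : vle (Some l) (v (x + y + - y)).
    apply: val_geD; last by rewrite valN vy.
    by case: (v (x + y)) Hk => //= w; apply: le_trans.
  by rewrite addrK vx /= => lg; have := lt_le_trans gl lg; rewrite ltxx.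
case: (v (x + y)) H => [k|] H /= Hk; last by case: (H h gh).
congr Some; apply/eqP; rewrite eq_sym; apply/negPn/negP => gk.
by case: (H k) => //=; rewrite lt_neqAle gk.
Qed.

(** By the strict ultrametric law, the nonzero term of least value decides the value of the sum. *)
Lemma val_sum_distinct (I : eqType) (r : seq I) (t : I -> K) : uniq r ->
  {in r &, forall i j, i != j -> t i != 0 -> v (t i) <> v (t j)} ->
  (forall i, i \in r -> t i = 0) \/
  exists2 i, i \in r & t i != 0 /\ v (\sum_(j <- r) t j) = v (t i).
Proof.
elim: r => [|i r IH] /=; first by move=> _ _; left.
move=> /andP[ir ur] H; have [||t0|[j jr [tj vj]]] := IH.
- by [].
- by move=> j k jr kr; apply: H; rewrite inE ?jr ?kr orbT.
- have [ti|ti] := eqVneq (t i) 0.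
    by left=> j; rewrite inE => /predU1P[->|/t0].
  right; exists i; first exact: mem_head.
  by split=> //; rewrite big_cons big_seq big1 ?addr0.
- right; have [ti|ti] := eqVneq (t i) 0.
    by exists j; rewrite ?inE ?jr ?orbT // big_cons ti add0r.
  have ij : i != j by apply: contraNneq ir => ->.
  have := H i j; rewrite mem_head inE jr orbT => /(_ isT isT ij ti).
  have [g vi] := valuation_neq0 v ti; have [h vtj] := valuation_neq0 v tj.
  rewrite big_cons vi vtj => gh; rewrite vtj in vj.
  case: (oag_leP g h) => [le|lt].
    exists i; rewrite ?mem_head // vi; split=> //; apply: (val_ltD vi vj).
    by rewrite lt_neqAle le andbT; apply/eqP => E; apply: gh; rewrite E.
  exists j; first by rewrite inE jr orbT.
  by rewrite vtj addrC; split=> //; apply: (val_ltD vj vi).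
Qed.

Lemma val_sum_eq0 (I : finType) (t : I -> K) i : \sum_j t j = 0 -> t i != 0 ->
  exists j k g, [/\ j != k, v (t j) = Some g & v (t k) = Some g].
Proof.
move=> t0 ti; apply: contrapT => H.
case: (@val_sum_distinct I (index_enum I) t (index_enum_uniq I)).
- move=> j k _ _ jk tj E; apply: H; have [g vj] := valuation_neq0 v tj.
  by exists j, k, g; split=> //; rewrite -E.
- by move=> /(_ i (mem_index_enum i)) /eqP; rewrite (negPf ti).
- move=> [j _ [tj]]; rewrite t0 val0 => /esym/valuation_eq_infty/eqP.
  by rewrite (negPf tj).
Qed.

End ValuationLemmas.

(** * Values of the solutions of a difference equation *)

Section TransformalValuation.
Variables (K : fieldType) (G : oagType) (v : valuation K G).
Variables (sigma : {rmorphism K -> K}) (hT : transformal v sigma).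
Hypothesis hw : omega_increasing v sigma.
Local Notation phi := (value_sigma v sigma).

Lemma value_sigmaD : {morph phi : g h / g + h}.
Proof.
move=> g h; have [x /eqP vx] := valuation_surj v g.
have [y /eqP vy] := valuation_surj v h.
have := value_sigmaE (x * y) hT.
by rewrite rmorphM !valuationM !(value_sigmaE _ hT) vx vy /= => -[].
Qed.

Lemma val_dmonom N (e : 'I_N -> nat) c g : v c = Some g ->
  v (\prod_(i < N) iter i sigma c ^+ e i) = Some (wsum phi e g).
Proof.
move=> vc; apply: val_prod => i; apply: valX; elim: (i : nat) => //= n IH.
by rewrite (value_sigmaE _ hT) IH.
Qed.

Lemma dependent_values_finite N D (k : {ffun 'I_N -> 'I_D} -> K) (S : set K) :
  (exists e, k e != 0) ->
  (forall c, S c -> \sum_e k e * \prod_(i < N) iter i sigma c ^+ e i = 0) ->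
  finite_set [set g | exists2 c, S c & v c = Some g].
Proof.
move=> [e0 ke0] HS.
(* The values [g] at which the terms [ee.1] and [ee.2] tie. There are finitely many pairs, and each
   set has at most one element by [wsum_eq_unique]. *)
pose F (ee : {ffun 'I_N -> 'I_D} * {ffun 'I_N -> 'I_D}) : set G :=
  [set g | exists x y, [/\ ee.1 != ee.2, v (k ee.1) = Some x,
    v (k ee.2) = Some y & x + wsum phi (fun i => ee.1 i : nat) g =
                          y + wsum phi (fun i => ee.2 i : nat) g]].
apply: (@sub_finite_set _ _ (\bigcup_(ee in setT) F ee)).
  move=> g [c Sc vc].
  have t0 : k e0 * \prod_(i < N) iter i sigma c ^+ e0 i != 0.
    apply/eqP => /(valuation_eq_infty v); rewrite valuationM (val_dmonom _ vc).
    by have [x ->] := valuation_neq0 v ke0.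
  have [e [e' [h [ee']]]] := val_sum_eq0 v (HS c Sc) t0.
  rewrite !valuationM !(val_dmonom _ vc).
  case E: (v (k e)) => [x|] //= -[<-]; case E': (v (k e')) => [y|] //= -[xy].
  by exists (e, e') => //; exists x, y.
apply: bigcup_finite; first exact: finite_finset.
move=> [e e'] _; have [[g Fg]|F0] := pselect (exists g, F (e, e') g).
  apply: (sub_finite_set _ (finite_set1 g)) => h [x [y [ee' Ex Ey E]]].
  have [x' [y' [_ Ex' Ey' E']]] := Fg.
  rewrite /= Ex Ey in Ex' Ey'; case: Ex' Ey' E' => <- [<-] E'.
  apply: (wsum_eq_unique value_sigmaD hw _ E E') => H.
  by case/eqP: ee'; apply/ffunP => i; apply/val_inj/H.
rewrite (_ : F _ = set0); first exact: finite_set0.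
by apply/seteqP; split=> // h Fh; apply: F0; exists h.
Qed.

End TransformalValuation.

(** * Finiteness of the set of values, and nested balls *)

Lemma root_differences_finite (K : fieldType) (G : oagType) (v : valuation K G)
    (sigma : {rmorphism K -> K}) (f : dpoly K) :
  transformal v sigma -> omega_increasing v sigma -> f != 0 ->
  finite_set [set g : G | exists a b : K,
      [/\ a <> b, deval sigma f a = 0, deval sigma f b = 0
        & v (a - b) = Some g]].
Proof.
move=> hT hw /(deval_pieces sigma)[n [Z [ZP rootZ]]].
pose S i j : set K := [set c | exists a b, [/\ Z i a, Z j b & c = a - b]].
apply: (@sub_finite_set _ _
  (\bigcup_(i in `I_n) \bigcup_(j in `I_n)
     [set g | exists2 c, S i j c & v c = Some g])).
  move=> g [a [b [_ /rootZ[i lti Za] /rootZ[j ltj Zb] vab]]].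
  exists i => //; exists j => //; exists (a - b) => //.
  by exists a, b.
apply: bigcup_finite => [|i lti]; first exact: finite_II.
apply: bigcup_finite => [|j ltj]; first exact: finite_II.
have [N [D [k [k0 H]]]] := pieces_dependent (ZP i lti) (ZP j ltj).
apply: (dependent_values_finite hT hw k0) => _ [a [b [Za Zb ->]]].
exact: H.
Qed.

Lemma nested_balls_root (K : fieldType) (G : oagType) (v : valuation K G)
    (Z : set K) (B : set (set K)) :
  finite_set [set g : G | exists a b : K,
      [/\ a <> b, Z a, Z b & v (a - b) = Some g]] ->
  B !=set0 ->
  (forall X, B X -> exists (c : K) (g : G), X = closed_ball v c g) ->
  (forall X Y, B X -> B Y -> X `<=` Y \/ Y `<=` X) ->
  (forall X, B X -> exists2 a, X a & Z a) ->
  exists2 a, (\bigcap_(X in B) X) a & Z a.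
Proof.
move=> finV [X0 BX0] ballB nested rootB; apply: contrapT => none.
have escape a : Z a -> exists2 X, B X & ~ X a.
  move=> Za; apply: contrapT => H; apply: none; exists a => // X BX.
  by apply: contrapT => Xa; apply: H; exists X.
(* Values of differences between a root outside a ball of the family and a root inside it. Without a
   common root this set is nonempty and has no maximum, yet it is finite. *)
pose V : set G := [set g | exists a b Y,
  [/\ Z a, Z b, B Y & [/\ ~ Y a, Y b & v (a - b) = Some g]]].
have Vex a Y : Z a -> B Y -> ~ Y a -> exists b g,
    [/\ Z b, Y b, v (a - b) = Some g & V g].
  move=> Za BY Ya; have [b Yb Zb] := rootB _ BY.
  have [|g vab] := @valuation_neq0 _ _ v (a - b).
    by rewrite subr_eq0; apply/eqP => ab; apply: Ya; rewrite ab.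
  by exists b, g; split=> //; exists a, b, Y.
have Vfin : finite_set V.
  apply: sub_finite_set finV => g [a [b [Y [Za Zb _ [Ya Yb vab]]]]].
  by exists a, b; split=> // ab; apply: Ya; rewrite ab.
have /finite_seqP[r Vr] := Vfin.
(* Leave [b] behind by a ball [W], which must then lie inside [Y], and take a root [c] in [W]. Both
   [b] and [c] lie in [Y], so [v (b - c)] is at least its radius [l], while [v (a - b) < l] because
   [a] is outside. *)
have Vnext g : V g -> exists2 h, V h & g < h.
  move=> [a [b [Y [Za Zb BY [Ya Yb vab]]]]].
  have [W BW Wb] := escape b Zb.
  have [c [h [Zc Wc vbc Vh]]] := Vex b W Zb BW Wb.
  exists h => //; have Yc : Y c.
    by case: (nested _ _ BY BW) => sub; [case: Wb; apply: sub|apply: sub].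
  have [c0 [l EY]] := ballB _ BY; rewrite EY /closed_ball /= in Ya Yb Yc.
  have lh : l <= h.
    have : vle (Some l) (v ((b - c0) + - (c - c0))).
      by apply: val_geD => //; rewrite valN.
    by rewrite opprB addrA subrK vbc.
  apply: lt_le_trans lh; case: (oag_leP l g) => // lg; case: Ya.
  by rewrite -(subrK b a) -addrA; apply: val_geD => //; rewrite vab.
have [a _ Za] := rootB _ BX0; have [Y BY Ya] := escape a Za.
have [_ [g [_ _ _ Vg]]] := Vex a Y Za BY Ya.
have r0 : r != [::] by apply/eqP => r0; move: Vg; rewrite Vr r0 /=.
have [m mr mP] := oag_seq_max r0.
have [|h Vh mh] := Vnext m; first by rewrite Vr.
have /mP hm : h \in r by rewrite Vr in Vh.
by have := lt_le_trans mh hm; rewrite ltxx.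
Qed.

Theorem mainTheorem5 (K : fieldType) (G : oagType) (v : valuation K G)
    (sigma : {rmorphism K -> K}) (hVFA : VFA v sigma)
    (f : dpoly K) (hf : f <> 0) :
  finite_set [set g : G | exists a b : K,
      [/\ a <> b, deval sigma f a = 0, deval sigma f b = 0
        & v (a - b) = Some g]] /\
  (forall B : set (set K),
     B !=set0 ->
     (forall X, B X -> exists (c : K) (g : G), X = closed_ball v c g) ->
     (forall X Y, B X -> B Y -> X `<=` Y \/ Y `<=` X) ->
     (forall X, B X -> exists2 a, X a & deval sigma f a = 0) ->
     exists2 a, (\bigcap_(X in B) X) a & deval sigma f a = 0).
Proof.
have fin := root_differences_finite (VFA_transformal hVFA)
  (VFA_omega_increasing hVFA) (introN eqP hf).
by split=> // B B0 ballB nested rootB; apply: (nested_balls_root fin).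
Qed.
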